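(* Let $(X_t)$, with $X_0=x\in\{0,1\}^\infty$, be a random walk $X_{t+1}=X_t+Z_t\bmod2$ on $\{0,1\}^\infty$, where $(Z_t)$ are i.i.d. de Finetti sequences with measure $\nu$. Let $T_\alpha$ be a stopping time with distribution $\mathbb P(T_\alpha=t)=(1-\alpha)\alpha^t$, $t=0,1,2,\dots$. Then $X_{T_\alpha}-x\bmod2$ is a de Finetti sequence with a measure which is the probability measure of $V:=\frac12-\frac Y2$.
   Context: A de Finetti sequence with measure $\mu$ (a probability measure on $[0,1]$) is an exchangeable $\{0,1\}$-valued sequence which, conditionally on $\omega$ with law $\mu$, is i.i.d. Bernoulli$(\omega)$. $\alpha\in(0,1)$; $T_\alpha$ is independent of the walk; $Z_t$ is independent of $(X_\tau)_{\tau\le t}$. $\nu^{[-1,1]}$ is the law of $1-2\omega$ when $\omega$ has law $\nu$. $Y\in[-1,1]$ is the product of the points in a point process with probability generating functional $G[f]=\mathbb E[\prod_jf(\xi_j)]=f(1)\big/\big(1+\frac{\alpha}{1-\alpha}\int_{[-1,1]}(1-f(\xi))\,\nu^{[-1,1]}(d\xi)\big)$, i.e. the point process consisting of a point at $1$ and $T_\alpha$ i.i.d. points with law $\nu^{[-1,1]}$. *)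

(* Defs.v *)
From HB Require Import structures.
From mathcomp Require Import all_boot all_order all_fingroup all_algebra.
From mathcomp Require Import all_classical all_reals all_analysis.
From mathcomp Require Import measurable_realfun.

Set Implicit Arguments.
Unset Strict Implicit.
Unset Printing Implicit Defensive.

Import Order.TTheory GRing.Theory Num.Theory.
Import numFieldNormedType.Exports.

Local Open Scope classical_set_scope.
Local Open Scope ring_scope.

(* [binseq] is {0,1}^oo with the product sigma-algebra, generated by the
   events "the i-th bit is b". Its group law is the pointwise one on
   [nat -> bool]; as a ring [bool] is Z/2 (addition is xor, and [-%R] is the
   identity), so [+%R] and [-%R] on [binseq] are coordinatewise addition and
   subtraction mod 2. *)
Definition coordinate_events : set (set (nat -> bool)) :=
  [set A | exists i b, A = [set z | z i = b]].

Definition binseq := g_sigma_algebraType coordinate_events.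

HB.instance Definition _ := GRing.Zmodule.copy binseq (nat -> bool).

Section de_finetti.
Context {d : measure_display} {T : measurableType d} {R : realType}.
Local Open Scope ereal_scope.

Definition exchangeable (P : probability T R) (Z : T -> binseq) : Prop :=
  forall (n : nat) (s : 'S_n) (e : 'I_n -> bool),
    P [set w | forall i : 'I_n, Z w (s i) = e i] =
    P [set w | forall i : 'I_n, Z w i = e i].

(* Integrating out p ~ mu: given p, the probability of the bits e of an
   i.i.d. Bernoulli(p) sequence is the product of the [bernoulli_pmf p (e i)].
   These probabilities for all n and e determine the law of Z. *)
Definition mixed_bernoulli (P : probability T R) (mu : probability R R)
    (Z : T -> binseq) : Prop :=
  forall (n : nat) (e : 'I_n -> bool),
    P [set w | forall i : 'I_n, Z w i = e i] =
    \int[mu]_(p in `[0%R, 1%R]%classic) (\prod_(i < n) bernoulli_pmf p (e i))%R%:E.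

Definition de_finetti (P : probability T R) (mu : probability R R)
    (Z : T -> binseq) : Prop :=
  [/\ measurable_fun [set: T] Z,
      mu `[0%R, 1%R]%classic = 1,
      exchangeable P Z &
      mixed_bernoulli P mu Z].

End de_finetti.

Section independence.
Context {d : measure_display} {T : measurableType d} {R : realType}.
Variable P : probability T R.
Local Open Scope ereal_scope.

Definition mutually_independent d' (S : measurableType d')
    (F : nat -> T -> S) : Prop :=
  forall (J : seq nat) (B : nat -> set S), uniq J ->
    (forall j, measurable (B j)) ->
    P (\bigcap_(j in [set` J]) F j @^-1` B j) =
    \prod_(j <- J) P (F j @^-1` B j).

Definition process_sigma_algebra d' (S : measurableType d')
    (F : nat -> T -> S) : set (set T) :=
  <<s \bigcup_t preimage_set_system setT (F t) measurable >>.

Definition independent_of_process d1 d2 (S1 : measurableType d1)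
    (S2 : measurableType d2) (tau : T -> S1) (F : nat -> T -> S2) : Prop :=
  forall (A : set S1) (E : set T), measurable A -> process_sigma_algebra F E ->
    P (tau @^-1` A `&` E) = P (tau @^-1` A) * P E.

End independence.

Section pm1.
Context {R : realType}.

Definition to_pm1 (p : R) : R := 1 - 2 * p.

Let measurable_to_pm1 : measurable_fun setT to_pm1.
Proof.
apply: measurable_funB; first exact: measurable_cst.
by apply: measurable_funM; [exact: measurable_cst | exact: measurable_id].
Qed.

HB.instance Definition _ := isMeasurableFun.Build _ _ _ _ to_pm1
  measurable_to_pm1.

Definition law_pm1 (nu : probability R R) : probability R R :=
  distribution nu to_pm1.

End pm1.

Section point_process.
Context {d : measure_display} {T : measurableType d} {R : realType}.

(* A point process on [-1,1] with finitely many points (with multiplicity),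
   given by an enumeration xi_0, ..., xi_(N-1); the xi_j with j >= N play no
   role. Its probability generating functional is specified on the measurable
   test functions f : [-1,1] -> [0,1] only. *)
Definition point_process_with_pgfl (P : probability T R) (N : {RV P >-> nat})
    (xi : nat -> {RV P >-> R}) (G : (R -> R) -> R) : Prop :=
  (forall w j, (j < N w)%N -> -1 <= xi j w <= 1) /\
  (forall f : R -> R, measurable_fun setT f ->
     (forall u, -1 <= u <= 1 -> 0 <= f u <= 1) ->
     'E_P[fun w => (\prod_(j < N w) f (xi j w))%R]%E = (G f)%:E).

Definition geometric_pgfl (alpha : R) (nu : probability R R) (f : R -> R) : R :=
  f 1 / (1 + alpha / (1 - alpha) *
             \int[law_pm1 nu]_(u in `[-1, 1]%classic) (1 - f u)).

End point_process.

(* Main.v *)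
Require Import Defs.
From HB Require Import structures.
From mathcomp Require Import all_boot all_order all_fingroup all_algebra.
From mathcomp Require Import all_classical all_reals all_analysis.
From mathcomp Require Import measurable_realfun ring lra.

Set Implicit Arguments.
Unset Strict Implicit.
Unset Printing Implicit Defensive.

Import Order.TTheory GRing.Theory Num.Theory.
Import numFieldNormedType.Exports.

Local Open Scope classical_set_scope.
Local Open Scope ring_scope.

(** The argument is Fourier analysis on the group {0,1}^n, applied to the
    first n bits of the displacement [X_T - x].

    For a set [S] of bit positions let [chi_S(e) = (-1)^(sum of e_i, i in S)].
    If [Z] is a Bernoulli mixture with measure [nu], then
    [E chi_S(Z) = b_|S|], where [b_k] is the integral of [(1 - 2p)^k] against
    [nu], that is, the k-th moment of [nu^[-1,1]]. The displacement at time [t]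
    is a sum of [t] independent copies, so its characters have mean [b_|S|^t],
    and averaging over the independent geometric time gives
    [(1 - alpha) / (1 - alpha b_|S|)] ([stopped_displacement_law]).

    On the other side, a Bernoulli mixture directed by [V = (1 - Y) / 2] has
    characters of mean [E Y^|S|]. As [Y^k] is the product of the [xi_j^k], this
    moment is the generating functional at [f(u) = u^k], whose value is
    [1 / (1 + alpha / (1 - alpha) (1 - b_k)) = (1 - alpha) / (1 - alpha b_k)].
    The two laws thus agree on every character, hence on every cylinder event.

    The functional is only given for [0,1]-valued test functions, whereas [u^k]
    is negative on [-1,0) when [k] is odd. Put [f_t = f^+ + t f^-]; for
    [0 <= t <= 1] the hypothesis applies to [f_t], and the product of the
    [f_t(xi_j)] is the product of the [|f(xi_j)|] times [t^M], with [M] the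
    number of points where [f] is negative. So the hypothesis determines, for
    [0 <= t <= 1], the generating function of [M] weighted by the product of
    the [|f(xi_j)|]. It is a geometric series there; a power series is
    determined by its values near [0], so the same formula holds at [t = -1],
    where [f_t] is [f] ([pgfl_signed]). *)

(** * Walsh characters on finitely many bits *)

Section walsh.
Context {R : realType} {n : nat}.
Implicit Types (S : {set 'I_n}) (e f : {ffun 'I_n -> bool}) (m : nat -> R).

Definition walsh_char S e : R := \prod_(i in S) (-1) ^+ e i.

(** The mass at [e] of the signed measure on {0,1}^n whose Walsh coefficient at
    [S] is [m #|S|]. Only the size of [S] matters, because all the laws
    considered here are exchangeable. *)
Definition walsh_inv m e : R := 2^-1 ^+ n * \sum_S walsh_char S e * m #|S|.

(** Bits subtract by exclusive or, so characters of a difference multiply. *)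
Lemma walsh_charB S e f :
  walsh_char S (e - f) = walsh_char S e * walsh_char S f.
Proof.
rewrite -big_split; apply: eq_bigr => i _.
rewrite !ffunE (_ : e i - f i = e i (+) f i)//.
by case: (e i); case: (f i); rewrite /= !(expr0, expr1, mulr1, mul1r, mulrNN).
Qed.

(** The bits are independent, so the sum factors over the positions. *)
Lemma walsh_char_bernoulli S (p : R) :
  \sum_(f : {ffun 'I_n -> bool})
     walsh_char S f * \prod_(i < n) bernoulli_pmf p (f i) = (1 - 2 * p) ^+ #|S|.
Proof.
transitivity (\sum_(f : {ffun 'I_n -> bool})
   \prod_(i < n)
     ((if i \in S then (-1) ^+ f i else 1) * bernoulli_pmf p (f i))).
  by apply: eq_bigr => f _; rewrite /walsh_char big_mkcond -big_split.
rewrite -(bigA_distr_bigA (fun (i : 'I_n) (b : bool) =>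
  (if i \in S then (-1) ^+ b else 1) * bernoulli_pmf p b)) /=.
rewrite -prodr_const [RHS]big_mkcond; apply: eq_bigr => i _.
by rewrite big_bool /bernoulli_pmf; case: (i \in S) => /=; ring.
Qed.

(** Each Bernoulli factor is [(1 + (-1)^(e i) (1 - 2p)) / 2]; expanding the
    product over the subsets of positions gives the Walsh inversion formula. *)
Lemma walsh_inv_exp (p : R) e :
  walsh_inv (fun k => (1 - 2 * p) ^+ k) e = \prod_(i < n) bernoulli_pmf p (e i).
Proof.
rewrite /walsh_inv.
transitivity (\prod_(i < n) (2^-1 * ((-1) ^+ e i * (1 - 2 * p) + 1)));
    last first.
  by apply: eq_bigr => i _; rewrite /bernoulli_pmf; case: (e i) => /=; field.
rewrite big_split /= prodr_const card_ord; congr (_ * _).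
rewrite bigA_distr; apply: eq_big => // S _; rewrite -big_mkcond.
by rewrite big_split/= prodr_const.
Qed.

(** The case [p = 0] of the preceding lemma: the law of the zero vector. *)
Lemma walsh_inv1 e : walsh_inv (fun=> 1) e = (e == 0)%:R.
Proof.
rewrite (_ : (fun=> 1) = (fun k => (1 - 2 * 0) ^+ k)); last first.
  by apply/funext => k; rewrite mulr0 subr0 expr1n.
rewrite walsh_inv_exp; have [->|e0] := eqVneq e 0.
  by rewrite big1// => i _; rewrite /bernoulli_pmf ffunE subr0.
have /forallPn[i] : ~~ [forall i, ~~ e i].
  apply: contraNN e0 => /forallP e0; apply/eqP/ffunP => i.
  by rewrite ffunE; exact: negbTE.
by rewrite negbK (bigD1 i)//= /bernoulli_pmf => ->; rewrite mul0r.
Qed.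

(** Convolution multiplies Walsh coefficients. *)
Lemma walsh_inv_convolution m b (q : {ffun 'I_n -> bool} -> R) e :
  (forall S, \sum_(f : {ffun 'I_n -> bool}) walsh_char S f * q f = b #|S|) ->
  \sum_(f : {ffun 'I_n -> bool}) walsh_inv m (e - f) * q f =
  walsh_inv (fun k => m k * b k) e.
Proof.
move=> qb; under eq_bigr do rewrite -mulrA big_distrl.
rewrite -big_distrr exchange_big /=; congr (_ * _).
apply: eq_bigr => S _; rewrite -qb !big_distrr.
by apply: eq_bigr => f _; rewrite /= walsh_charB; ring.
Qed.

End walsh.

(** * Measure-theoretic preliminaries *)

Section measure_preliminaries.
Context {d : measure_display} {T : measurableType d} {R : realType}.

Lemma measure_fibers (mu : {measure set T -> \bar R}) (I : finType) (g : T -> I)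
    (A : set T) : (forall i, measurable (A `&` g @^-1` [set i])) ->
  mu A = (\sum_(i : I) mu (A `&` g @^-1` [set i]))%E.
Proof.
move=> mA; rewrite fsbig_seq ?index_enum_uniq//.
rewrite -measure_fin_bigcup//.
- congr (mu _); apply/seteqP; split=> [w Aw|w [i _ []//]].
  by exists (g w) => //=; rewrite mem_index_enum.
- by move=> i j _ _ [w [[_ /= <-] [_ /= <-]]].
Qed.

Lemma bounded_integrable (P : probability T R) (D : set T) (f : T -> R)
    (M : R) :
  measurable D -> measurable_fun D f -> (forall w, D w -> `|f w| <= M) ->
  P.-integrable D (EFin \o f).
Proof.
move=> mD mf fM; apply: measurable_bounded_integrable => //.
  by rewrite (le_lt_trans (probability_le1 P mD))// ltry.
exists M; split; first exact: num_real.
by move=> x Mx w Dw /=; rewrite (le_trans (fM w Dw))// ltW.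
Qed.

Lemma EFin_Rintegral (mu : {measure set T -> \bar R}) (D : set T) (f : T -> R) :
  measurable D -> mu.-integrable D (EFin \o f) ->
  (\int[mu]_(w in D) f w)%:E = (\int[mu]_(w in D) (f w)%:E)%E.
Proof. by move=> mD fi; rewrite fineK//; exact: integrable_fin_num. Qed.

Lemma norm_Rintegral_le1 (P : probability T R) (D : set T) (f : T -> R) :
  measurable D -> measurable_fun D f -> (forall w, D w -> `|f w| <= 1) ->
  `|\int[P]_(w in D) f w| <= 1.
Proof.
move=> mD mf f1; rewrite (le_trans (le_normr_Rintegral _ _))//.
  exact: (@bounded_integrable P _ _ 1).
apply: (@le_trans _ _ (\int[P]_(w in D) 1)).
  apply: le_Rintegral => //.
    apply: (@bounded_integrable P _ _ 1) => //.
      exact: measurableT_comp.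
    by move=> w Dw; rewrite normr_id f1.
  by apply: (@bounded_integrable P _ _ 1) => // w _; rewrite normr1.
rewrite Rintegral_cst// mul1r -lee_fin fineK ?fin_num_measure//.
exact: probability_le1.
Qed.

(** Evaluation at a random index: used for the walk at its stopping time and for
    products over a random number of points. *)
Lemma measurable_fun_random_index d' (S : measurableType d') (N : T -> nat)
    (F : nat -> T -> S) :
  measurable_fun setT N -> (forall n, measurable_fun setT (F n)) ->
  measurable_fun setT (fun w => F (N w) w).
Proof.
move=> mN mF _ B mB; rewrite setTI.
rewrite (_ : _ @^-1` _ = \bigcup_n (N @^-1` [set n] `&` F n @^-1` B)).
  apply: bigcupT_measurable => n; rewrite -[X in measurable X]setTI setIIr.
  by apply: measurableI; [exact: mN|exact: mF].
apply/seteqP; split=> [w FNw|w [n _ [/= <-]]]//.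
by exists (N w).
Qed.

End measure_preliminaries.

(** * Cylinder events *)

Section cylinders.
Context {n : nat}.

Definition bits (z : binseq) : {ffun 'I_n -> bool} := [ffun i => z (val i)].

Lemma measurable_coordinate i b : measurable [set z : binseq | z i = b].
Proof. by apply: sub_sigma_algebra; exists i, b. Qed.

Lemma measurable_bits (e : {ffun 'I_n -> bool}) :
  measurable (bits @^-1` [set e]).
Proof.
rewrite (_ : _ @^-1` _ = \bigcap_(i : 'I_n) [set z : binseq | z i = e i]).
  by apply: fin_bigcap_measurable => // i _; exact: measurable_coordinate.
apply/seteqP; split=> [z /= <- i _/=|z ze /=]; first by rewrite ffunE.
by apply/ffunP => i; rewrite ffunE; exact: ze.
Qed.

Lemma bitsD : {morph bits : y z / y + z}.
Proof. by move=> y z; apply/ffunP => i; rewrite !ffunE. Qed.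

Lemma bitsB : {morph bits : y z / y - z}.
Proof. by move=> y z; apply/ffunP => i; rewrite !ffunE. Qed.

Lemma bits_preimage T (W : T -> binseq) (e : 'I_n -> bool) :
  [set w | forall i : 'I_n, W w i = e i] = W @^-1` (bits @^-1` [set finfun e]).
Proof.
apply/seteqP; split=> w /=.
  by move=> We; apply/ffunP => i; rewrite !ffunE; exact: We.
by move=> /ffunP We i; have := We i; rewrite !ffunE.
Qed.

End cylinders.

Lemma measurable_fun_binseq d (T : measurableType d) (W : T -> binseq) :
  (forall i b, measurable [set w | W w i = b]) -> measurable_fun setT W.
Proof.
move=> mW; apply: (@measurability _ _ T binseq setT W coordinate_events) => //.
move=> _ [_ [i [b ->]] <-].
by rewrite setTI; exact: mW.
Qed.

(** * Bernoulli mixtures *)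

(** The k-th moment of [law_pm1 nu] on [-1,1], written on the scale of [nu]. *)
Definition bit_moment {R : realType} (nu : probability R R) (k : nat) : R :=
  \int[nu]_(p in `[0, 1]) (1 - 2 * p) ^+ k.

Section bernoulli_mixture.
Context {R : realType} (nu : probability R R) {n : nat}.

Lemma measurable_bernoulli_prod (D : set R) (e : {ffun 'I_n -> bool}) :
  measurable_fun D (fun p : R => \prod_(i < n) bernoulli_pmf p (e i)).
Proof. by apply: measurable_prod => i _; exact: measurable_bernoulli_pmf. Qed.

Lemma bernoulli_prod_bound (e : {ffun 'I_n -> bool}) (p : R) :
  0 <= p <= 1 -> `|\prod_(i < n) bernoulli_pmf p (e i)| <= 1.
Proof.
move=> p01; rewrite normr_prod; apply: prodr_ile1 => i _.
by rewrite normr_ge0 /= /bernoulli_pmf; case: (e i); rewrite ger0_norm; lra.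
Qed.

Lemma integrable_bernoulli_prod (e : {ffun 'I_n -> bool}) :
  nu.-integrable `[0, 1]
    (fun p : R => (\prod_(i < n) bernoulli_pmf p (e i))%:E).
Proof.
apply: (@bounded_integrable _ _ _ nu _ _ 1) => //;
  first exact: measurable_bernoulli_prod.
by move=> p /=; rewrite in_itv/=; exact: bernoulli_prod_bound.
Qed.

Lemma pm1_exp_bound k (p : R) : 0 <= p <= 1 -> `|(1 - 2 * p) ^+ k| <= 1.
Proof. by move=> p01; rewrite normrX exprn_ile1// ler_norml; lra. Qed.

Lemma measurable_pm1_exp (D : set R) k :
  measurable_fun D (fun p : R => (1 - 2 * p) ^+ k).
Proof.
by apply: measurable_funX; apply: measurable_funB => //; exact: measurable_funM.
Qed.

Lemma integrable_pm1_exp k :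
  nu.-integrable `[0, 1] (EFin \o (fun p : R => (1 - 2 * p) ^+ k)).
Proof.
apply: (@bounded_integrable _ _ _ nu _ _ 1) => //;
  first exact: measurable_pm1_exp.
by move=> p /=; rewrite in_itv/=; exact: pm1_exp_bound.
Qed.

Lemma bit_moment_le1 k : `|bit_moment nu k| <= 1.
Proof.
apply: norm_Rintegral_le1 => //; first exact: measurable_pm1_exp.
by move=> p /=; rewrite in_itv/=; exact: pm1_exp_bound.
Qed.

Lemma walsh_char_mixture (S : {set 'I_n}) :
  \sum_(f : {ffun 'I_n -> bool}) walsh_char S f *
    \int[nu]_(p in `[0, 1]) \prod_(i < n) bernoulli_pmf p (f i) =
  bit_moment nu #|S|.
Proof.
apply: EFin_inj; rewrite -sumEFin.
transitivity (\sum_(f : {ffun 'I_n -> bool}) \int[nu]_(p in `[0%R, 1%R])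
    (walsh_char S f * \prod_(i < n) bernoulli_pmf p (f i))%:E)%E.
  apply: eq_bigr => f _ /=; rewrite EFinM EFin_Rintegral//.
    by rewrite -integralZl//; exact: integrable_bernoulli_prod.
  exact: integrable_bernoulli_prod.
rewrite -integral_sum//; last first.
  move=> f; rewrite (_ : (fun _ => _) = (fun p : R =>
    (walsh_char S f)%:E * (\prod_(i < n) bernoulli_pmf p (f i))%:E)%E)//.
  by apply: integrableZl => //; exact: integrable_bernoulli_prod.
under eq_integral do rewrite sumEFin walsh_char_bernoulli.
by rewrite EFin_Rintegral//; exact: integrable_pm1_exp.
Qed.

End bernoulli_mixture.

(** Permuting the positions permutes the factors of the Bernoulli product. *)
Lemma mixed_bernoulli_exchangeable d (T : measurableType d) (R : realType)
    (P : probability T R) (mu : probability R R) (W : T -> binseq) :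
  mixed_bernoulli P mu W -> exchangeable P W.
Proof.
move=> W_mixed n s e.
rewrite (_ : [set w | _] = [set w | forall i : 'I_n, W w i = e ((s^-1)%g i)]).
  rewrite !W_mixed; apply: eq_integral => p _; congr EFin.
  rewrite (reindex_inj (@perm_inj _ s)).
  by apply: eq_bigr => i _; rewrite permK.
apply/seteqP; split=> w /= We i.
  by rewrite -We permKV.
by rewrite We permK.
Qed.

(** * The walk at a fixed time *)

Section walk.
Context {d : measure_display} {Omega : measurableType d} {R : realType}.
Variables (P : probability Omega R) (nu : probability R R) (x : binseq).
Variables (Z X : nat -> {RV P >-> binseq}).
Hypothesis Z_mixed : forall t, mixed_bernoulli P nu (Z t).
Hypothesis Z_indep : mutually_independent P Z.
Hypothesis X0 : forall w, X 0%N w = x.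
Hypothesis XS : forall t w, X t.+1 w = X t w + Z t w.
Context {n : nat}.

Definition displacement t w : {ffun 'I_n -> bool} := bits (X t w - x).

Lemma increment_law t (e : {ffun 'I_n -> bool}) :
  P (Z t @^-1` (bits @^-1` [set e])) =
  (\int[nu]_(p in `[0, 1]) \prod_(i < n) bernoulli_pmf p (e i))%:E.
Proof.
rewrite EFin_Rintegral//; last exact: integrable_bernoulli_prod.
rewrite -(Z_mixed t) bits_preimage; congr (P (_ @^-1` (_ @^-1` [set _]))).
by apply/ffunP => i; rewrite ffunE.
Qed.

Lemma measurable_displacement t (e : {ffun 'I_n -> bool}) :
  measurable (displacement t @^-1` [set e]).
Proof.
rewrite (_ : _ @^-1` _ = X t @^-1` (bits @^-1` [set e + bits x])).
  rewrite -[X in measurable X]setTI; apply: measurable_funPT => //.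
  exact: measurable_bits.
rewrite /displacement; apply/seteqP; split=> w /=; rewrite bitsB.
  by move=> <-; rewrite subrK.
by move=> ->; rewrite addrK.
Qed.

Lemma displacementS t w : displacement t.+1 w = displacement t w + bits (Z t w).
Proof. by rewrite /displacement XS addrAC bitsD. Qed.

(** The independence hypothesis speaks of finitely many increments at a time,
    not of the walk. Carrying along an arbitrary event on increments from time
    [t] on makes the induction go through: at time [t + 1], splitting according
    to the bits of [Z t] turns that increment into one more coordinate of the
    event, and the remaining sum is a convolution. *)
Lemma displacement_joint_law t (J : seq nat) (B : nat -> set binseq)
    (e : {ffun 'I_n -> bool}) :
  uniq J -> {in J, forall j, (t <= j)%N} -> (forall j, measurable (B j)) ->
  P (displacement t @^-1` [set e] `&` \bigcap_(j in [set` J]) Z j @^-1` B j) =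
  ((walsh_inv (fun k => bit_moment nu k ^+ t) e)%:E *
   P (\bigcap_(j in [set` J]) Z j @^-1` B j))%E.
Proof.
elim: t J B e => [|t IH] J B e uJ tJ mB.
  rewrite walsh_inv1; set E := \bigcap_(j in _) _.
  have [->|e0] := eqVneq e 0.
    rewrite mul1e; congr (P _); apply/seteqP; split=> [w []//|w Ew].
    split=> //=; rewrite /displacement X0 subrr.
    by apply/ffunP => i; rewrite !ffunE.
  rewrite mul0e (_ : _ `&` _ = set0) ?measure0//.
  rewrite -subset0 => w [/= + _]; rewrite /displacement X0 subrr => De.
  by move/negP: e0; apply; rewrite -De; apply/eqP/ffunP => i; rewrite !ffunE.
have mE (K : seq nat) C : (forall j, measurable (C j)) ->
    measurable (\bigcap_(j in [set` K]) Z j @^-1` C j).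
  move=> mC; apply: fin_bigcap_measurable => // j _.
  by rewrite -[X in measurable X]setTI; exact: measurable_funPT.
set E := \bigcap_(j in _) _.
have tNJ : t \notin J by apply/negP => /tJ; rewrite ltnn.
(* [C f] adds to [B] the constraint that the bits of [Z t] are [f] *)
pose C (f : {ffun 'I_n -> bool}) j :=
  if j == t then bits @^-1` [set f] else B j.
have mC f j : measurable (C f j).
  by rewrite /C; case: ifP => // _; exact: measurable_bits.
have CE f : \bigcap_(j in [set` t :: J]) Z j @^-1` C f j =
    Z t @^-1` (bits @^-1` [set f]) `&` E.
  apply/seteqP; split=> [w Cw|w [/= Zt Ew] j].
    split=> [|j jJ]; first by have := Cw t (mem_head _ _); rewrite /= /C eqxx.
    have /= := Cw j; rewrite /C inE jJ orbT.
    by case: eqP => [jt|_]; [rewrite -jt jJ in tNJ|exact].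
  rewrite /= inE /C => /predU1P[->|jJ]; first by rewrite eqxx.
  by case: eqP => [->|_]//; exact: Ew.
have stepE f : displacement t.+1 @^-1` [set e] `&` E `&`
      (fun w => bits (Z t w)) @^-1` [set f] =
    displacement t @^-1` [set e - f] `&`
      \bigcap_(j in [set` t :: J]) Z j @^-1` C f j.
  rewrite CE; apply/seteqP; split=> w /=; rewrite displacementS.
    by move=> [[<- Ew] <-]; rewrite addrK.
  by move=> [-> [-> Ew]]; rewrite subrK.
rewrite (@measure_fibers _ _ _ P _ (fun w => @bits n (Z t w))); last first.
  move=> f; rewrite stepE; apply: measurableI; last exact: mE.
  exact: measurable_displacement.
transitivity (\sum_(f : {ffun 'I_n -> bool})
  ((walsh_inv (fun k => bit_moment nu k ^+ t) (e - f))%:E *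
   P (\bigcap_(j in [set` t :: J]) Z j @^-1` C f j)))%E.
  apply: eq_bigr => f _; rewrite stepE; apply: IH => //=.
  - by rewrite tNJ.
  - by move=> j; rewrite inE => /predU1P[->//|/tJ/ltnW].
have PE : P E = (fine (P E))%:E by rewrite fineK// fin_num_measure//; exact: mE.
transitivity ((\sum_(f : {ffun 'I_n -> bool})
  (walsh_inv (fun k => bit_moment nu k ^+ t) (e - f) *
   \int[nu]_(p in `[0, 1]) \prod_(i < n) bernoulli_pmf p (f i)))%:E * P E)%E.
  rewrite PE -EFinM big_distrl -sumEFin; apply: eq_bigr => f _.
  move: (walsh_inv _ _) => u /=.
  rewrite !EFinM -(increment_law t) -PE -muleA; congr (_ * _)%E.
  rewrite [P E](Z_indep uJ mB); apply: etrans (Z_indep _ (mC f)) _.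
    by rewrite /= tNJ.
  rewrite big_cons /C eqxx; congr (_ * _)%E.
  rewrite big_seq [RHS]big_seq; apply: eq_bigr => j jJ.
  by case: eqP => // jt; rewrite -jt jJ in tNJ.
rewrite (walsh_inv_convolution _ _ (walsh_char_mixture nu)).
by under [in RHS]eq_fun do rewrite exprSr.
Qed.

End walk.

(** * The walk at a geometric time *)

(** Coefficientwise, this is the geometric series in [a * b k]. *)
Lemma walsh_geometric_series {R : realType} n (a : R) (b : nat -> R)
    (e : {ffun 'I_n -> bool}) : 0 < a < 1 -> (forall k, `|b k| <= 1) ->
  series (fun t => (1 - a) * a ^+ t * walsh_inv (fun k => b k ^+ t) e) @ \oo -->
  walsh_inv (fun k => (1 - a) / (1 - a * b k)) e.
Proof.
move=> a01 b1.
rewrite (_ : series _ = fun N =>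
    walsh_inv (fun k => series (geometric (1 - a) (a * b k)) N) e).
  rewrite /walsh_inv; apply: cvgMl_tmp.
  apply: cvg_big => [|S _]; first exact: add_continuous.
  apply: cvgMl_tmp; apply: cvg_geometric_series.
  have := b1 #|S|; rewrite normrM; case/andP: a01 => a0 a1 bS.
  by rewrite (le_lt_trans _ a1)// gtr0_norm// ler_piMr// ltW.
apply/funext => N; rewrite /series /walsh_inv /=.
under eq_bigr do rewrite mulrCA.
rewrite -big_distrr; congr (_ * _) => /=.
under eq_bigr do rewrite big_distrr.
rewrite exchange_big; apply: eq_bigr => S _ /=; rewrite big_distrr.
by apply: eq_bigr => t _ /=; rewrite exprMn; ring.
Qed.

Section stopped_walk.
Context {d : measure_display} {Omega : measurableType d} {R : realType}.
Variables (P : probability Omega R) (nu : probability R R) (alpha : R).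
Variable x : binseq.
Variables (Z X : nat -> {RV P >-> binseq}) (T : {RV P >-> nat}).
Hypothesis alpha01 : 0 < alpha < 1.
Hypothesis Z_mixed : forall t, mixed_bernoulli P nu (Z t).
Hypothesis Z_indep : mutually_independent P Z.
Hypothesis X0 : forall w, X 0%N w = x.
Hypothesis XS : forall t w, X t.+1 w = X t w + Z t w.
Hypothesis T_geometric : forall t : nat,
  P [set w | T w = t] = ((1 - alpha) * alpha ^+ t)%:E.
Hypothesis T_indep : independent_of_process P T X.
Context {n : nat}.

Lemma displacement_law t (e : {ffun 'I_n -> bool}) :
  P (displacement x X t @^-1` [set e]) =
  (walsh_inv (fun k => bit_moment nu k ^+ t) e)%:E.
Proof.
have := @displacement_joint_law _ _ _ P nu x Z X Z_mixed Z_indep X0 XS n t [::]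
  (fun=> setT) e isT.
by rewrite set_nil bigcap_set0 setIT probability_setT mule1; apply.
Qed.

(** Split according to the value [t] of the stopping time, which is independent
    of the displacement at time [t], and sum the series. *)
Lemma stopped_displacement_law (e : {ffun 'I_n -> bool}) :
  P [set w | bits (X (T w) w - x) = e] =
  (walsh_inv (fun k => (1 - alpha) / (1 - alpha * bit_moment nu k)) e)%:E.
Proof.
rewrite (_ : [set w | _] =
    \bigcup_t ([set w | T w = t] `&` displacement x X t @^-1` [set e]));
  last first.
  apply/seteqP; split=> [w Xe|w [t _ [/= <-]]//]; by exists (T w).
have mT t : measurable [set w | T w = t].
  rewrite (_ : [set w | _] = T @^-1` [set t])//.
  by rewrite -[X in measurable X]setTI; exact: measurable_funPT.
rewrite measure_bigcup//.
- rewrite (eq_eseriesr (g := fun t => ((1 - alpha) * alpha ^+ t *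
      walsh_inv (fun k => bit_moment nu k ^+ t) e)%:E)).
    apply: cvg_lim => //; under eq_fun do rewrite sumEFin.
    apply: cvg_EFin; first exact: nearW.
    apply: cvg_trans;
      last exact: (walsh_geometric_series alpha01 (bit_moment_le1 nu)).
    apply: near_eq_cvg; apply: nearW => N /=.
    by under [RHS]eq_bigl do rewrite in_setT.
  move=> t _; rewrite EFinM -displacement_law -T_geometric.
  apply: (@T_indep [set t]) => //; apply: sub_sigma_algebra; exists t => //.
  exists (bits @^-1` [set e + bits x]); first exact: measurable_bits.
  rewrite setTI /displacement; apply/seteqP; split=> w /=; rewrite bitsB.
    by move=> ->; rewrite addrK.
  by move=> <-; rewrite subrK.
- by move=> t _; apply: measurableI => //; exact: measurable_displacement.
- by move=> s t _ _ [w [[/= <- _] [/= <- _]]].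
Qed.

End stopped_walk.

(** * Power series determined on the unit interval *)

Section power_series.
Context {R : realType}.

(** If the coefficients before the k-th vanish, dividing the series by [t^k]
    leaves [u k + O(t)]; letting [t] tend to [0] gives [u k = 0]. *)
Lemma power_series_eq0 (u : nat -> R) (C : R) :
  (forall n, \sum_(0 <= k < n) `|u k| <= C) ->
  (forall t, 0 < t < 1 -> series (fun k => u k * t ^+ k) @ \oo --> 0) ->
  forall k, u k = 0.
Proof.
move=> uC u0; elim/ltn_ind => k IH.
(* otherwise the partial sums stay away from 0 by [t ^+ k * (`|u k| - t * C)] *)
have uk_le t : 0 < t < 1 -> `|u k| <= t * C.
  move=> t01; have t0 : 0 < t by case/andP: t01.
  rewrite leNgt; apply/negP => tC.
  have /cvgr0_norm_lt := u0 _ t01.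
  move=> /(_ (t ^+ k * (`|u k| - t * C))).
  rewrite mulr_gt0 ?exprn_gt0 ?subr_gt0// => /(_ isT) [n _ /(_ (maxn n k.+1))].
  rewrite /= leq_maxl; move: (maxn n k.+1) (leq_maxr n k.+1) => m km /(_ isT).
  rewrite /series /= (@big_cat_nat _ _ _ k 0 m)//=; last exact: ltnW.
  rewrite big_nat big1 ?add0r; last by move=> j /andP[_ jk]; rewrite IH ?mul0r.
  rewrite big_ltn//; set r := \sum_(k.+1 <= j < m) _.
  have rC : `|r| <= t ^+ k.+1 * C.
    rewrite (le_trans (ler_norm_sum _ _ _))//.
    apply: (@le_trans _ _ (t ^+ k.+1 * \sum_(k.+1 <= j < m) `|u j|)).
      rewrite mulr_sumr; apply: ler_sum_nat => j /andP[kj _].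
      rewrite normrM mulrC ler_wpM2r// normrX gtr0_norm//.
      by rewrite ler_wiXn2l// ltW//; case/andP: t01.
    rewrite ler_wpM2l//; first by rewrite exprn_ge0// ltW.
    apply: le_trans _ (uC m).
    by rewrite [leRHS](@big_cat_nat _ _ _ k.+1 0 m)//= lerDr sumr_ge0.
  rewrite ltNge => /negP; apply.
  rewrite mulrBr mulrA -exprSr -[t ^+ k in leLHS]gtr0_norm ?exprn_gt0//.
  rewrite mulrC -normrM.
  by rewrite (le_trans _ (lerB_normD _ _))// lerD2l lerN2.
apply/eqP; rewrite -normr_le0 leNgt; apply/negP => uk0.
have ukC : `|u k| <= C.
  by apply: le_trans _ (uC k.+1); rewrite big_nat_recr//= lerDr sumr_ge0.
have C1 : 0 < C by exact: lt_le_trans ukC.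
(* any [t] below [`|u k| / C] contradicts [uk_le] *)
have := uk_le (`|u k| / (2 * C)); rewrite divr_gt0 ?mulr_gt0//=.
rewrite ltr_pdivrMr ?mulr_gt0//; have -> : `|u k| < 1 * (2 * C) by lra.
move=> /(_ isT); have -> : `|u k| / (2 * C) * C = `|u k| / 2.
  by field; rewrite gt_eqF.
by lra.
Qed.

(** The value at [t = 1] bounds the sums of coefficients, which is the
    summability that the uniqueness argument needs. *)
Lemma geometric_coefficients (a : nat -> R) (l r : R) :
  0 <= l -> 0 <= r < 1 -> (forall k, 0 <= a k) ->
  (forall t, 0 <= t <= 1 ->
     series (fun k => t ^+ k * a k) @ \oo --> l / (1 - r * t)) ->
  forall k, a k = l * r ^+ k.
Proof.
move=> l0 /andP[r0 r1] a0 at_cvg k; apply/eqP; rewrite -subr_eq0; apply/eqP.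
have r_norm t : 0 <= t <= 1 -> `|r * t| < 1.
  move=> /andP[t0 t1]; rewrite normrM !ger0_norm// (le_lt_trans _ r1)//.
  by rewrite ler_piMr.
have geo t : 0 <= t <= 1 ->
    series (fun k => t ^+ k * (l * r ^+ k)) @ \oo --> l / (1 - r * t).
  move=> /r_norm /(cvg_geometric_series (a := l)).
  apply: cvg_trans; apply: near_eq_cvg; apply: nearW => n.
  by rewrite /series; apply: eq_bigr => j _; rewrite /= exprMn; ring.
have part (v : nat -> R) n : (forall k, 0 <= v k) ->
    series (fun k => 1 ^+ k * v k) @ \oo --> l / (1 - r * 1) ->
    \sum_(0 <= k < n) v k <= l / (1 - r * 1).
  move=> v0 vl; rewrite -(cvg_lim _ vl)//.
  rewrite (_ : \sum_(0 <= k < n) v k = series (fun k => 1 ^+ k * v k) n).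
    apply: nondecreasing_cvgn_le; last by apply/cvg_ex; eexists; exact: vl.
    apply/nondecreasing_seqP => m.
    by rewrite /series/= big_nat_recr//= lerDl expr1n mul1r.
  by apply: eq_bigr => j _; rewrite expr1n mul1r.
have h1 : (0 : R) <= 1 <= (1 : R) by apply/andP.
apply: (@power_series_eq0 (fun k => a k - l * r ^+ k)
    (l / (1 - r * 1) + l / (1 - r * 1))).
  move=> n; apply: (@le_trans _ _
    (\sum_(0 <= j < n) a j + \sum_(0 <= j < n) l * r ^+ j)).
    rewrite -big_split; apply: ler_sum => j _ /=.
    rewrite (le_trans (ler_normB _ _))//.
    by rewrite !ger0_norm// mulr_ge0// exprn_ge0.
  apply: lerD; apply: part => //; first exact: (at_cvg 1 h1).
    by move=> j; rewrite mulr_ge0// exprn_ge0.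
  exact: (geo 1 h1).
move=> t /andP[/ltW t0 /ltW t1]; have t01 : 0 <= t <= 1 by rewrite t0.
rewrite -[0](subrr (l / (1 - r * t))).
rewrite (_ : series _ = series (fun k => t ^+ k * a k) \-
    series (fun k => t ^+ k * (l * r ^+ k))).
  by apply: cvgB; [exact: at_cvg|exact: geo].
apply/funext => n; rewrite /series /= -sumrB; apply: eq_bigr => j _; ring.
Qed.

End power_series.

(** * Generating functions of a weighted count *)

Section count_series.
Context {d : measure_display} {T : measurableType d} {R : realType}.
Variables (P : probability T R) (A : T -> R) (M : T -> nat).
Hypotheses (mA : measurable_fun setT A) (mM : measurable_fun setT M).
Hypothesis A01 : forall w, 0 <= A w <= 1.

Let m_fiber m : measurable (M @^-1` [set m]).
Proof. by rewrite -[X in measurable X]setTI; exact: mM. Qed.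

Lemma measurable_weight (b : nat -> R) :
  measurable_fun setT (fun w => A w * b (M w)).
Proof.
apply: measurable_funM => //.
by apply: (measurableT_comp (f := b)) => // _ B mB.
Qed.

(** Integrate over the fibers of [M]. Nonnegative [b] allow monotone
    convergence. *)
Lemma count_series (b : nat -> R) (K : R) : (forall m, 0 <= b m <= K) ->
  series (fun m => b m * \int[P]_(w in M @^-1` [set m]) A w) @ \oo -->
  \int[P]_w (A w * b (M w)).
Proof.
move=> bK.
have b0 m : 0 <= b m by case/andP: (bK m).
have intA m : P.-integrable (M @^-1` [set m]) (EFin \o A).
  apply: (@bounded_integrable _ _ _ P _ _ 1) => //;
    first exact: measurable_funTS.
  by move=> w _; case/andP: (A01 w) => A0 A1; rewrite ger0_norm.
have intAb : P.-integrable setT (EFin \o (fun w => A w * b (M w))).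
  apply: (@bounded_integrable _ _ _ P _ _ K) => //;
    first exact: measurable_weight.
  move=> w _; case/andP: (A01 w) => A0 A1; case/andP: (bK (M w)) => bM0 bMK.
  by rewrite ger0_norm ?mulr_ge0// -[leRHS]mul1r ler_pM.
apply: (fine_cvg (f := fun n =>
  (\sum_(0 <= m < n) b m * \int[P]_(w in M @^-1` [set m]) A w)%:E)).
rewrite EFin_Rintegral//.
rewrite (_ : setT = \bigcup_m (M @^-1` [set m])); last first.
  by apply/seteqP; split=> // w _; exists (M w).
rewrite ge0_integral_bigcup//=; first last.
- by move=> m n _ _ [w [/= <- <-]].
- by move=> w _; rewrite lee_fin mulr_ge0//; case/andP: (A01 w).
- apply: measurable_funTS; apply/measurable_EFinP; exact: measurable_weight.
rewrite (eq_eseriesr (g := fun m =>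
    (b m * \int[P]_(w in M @^-1` [set m]) A w)%:E)).
  under eq_fun do rewrite -sumEFin.
  apply: is_cvg_nneseries => m _ _; rewrite lee_fin mulr_ge0//.
  by apply: Rintegral_ge0 => w _; case/andP: (A01 w).
move=> m _; rewrite EFinM EFin_Rintegral// -integralZl//.
by apply: eq_integral => w; rewrite inE /= => ->; rewrite mulrC.
Qed.

(** The generating function of [M] weighted by [A] is geometric on [0,1], so its
    coefficients are geometric and it keeps the same form at [-1]. The weight
    [(-1)^m] is reached through the nonnegative weight [1 + (-1)^m], to which
    the series expansion applies. *)
Lemma signed_generating_function (l r : R) : 0 <= l -> 0 <= r < 1 ->
  (forall t : R, 0 <= t <= 1 -> \int[P]_w (A w * t ^+ M w) = l / (1 - r * t)) ->
  \int[P]_w (A w * (-1) ^+ M w) = l / (1 + r).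
Proof.
move=> l0 /andP[r0 r1] gen.
have coef := @geometric_coefficients _
  (fun m => \int[P]_(w in M @^-1` [set m]) A w) l r l0.
have {}coef m : \int[P]_(w in M @^-1` [set m]) A w = l * r ^+ m.
  apply: coef; first by rewrite r0.
    by move=> k; apply: Rintegral_ge0 => w _; case/andP: (A01 w).
  move=> t t01; rewrite -gen//; apply: (@count_series _ 1) => k.
  by case/andP: t01 => t0 t1; rewrite exprn_ge0//= exprn_ile1.
have int_sign : P.-integrable setT (EFin \o (fun w => A w * (-1) ^+ M w)).
  apply: (@bounded_integrable _ _ _ P _ _ 1) => //;
    first exact: measurable_weight.
  move=> w _; case/andP: (A01 w) => A0 A1.
  by rewrite normrM normrX normrN1 expr1n mulr1 ger0_norm.
have intA : P.-integrable setT (EFin \o A).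
  apply: (@bounded_integrable _ _ _ P _ _ 1) => //.
  by move=> w _; case/andP: (A01 w) => A0 A1; rewrite ger0_norm.
have bnd m : 0 <= (1 + (-1) ^+ m : R) <= 2.
  rewrite -signr_odd; case: (odd m); rewrite ?expr1 ?expr0.
    by apply/andP; split; lra.
  by apply/andP; split; lra.
have := count_series bnd.
under [X in _ --> X]eq_Rintegral do rewrite mulrDr mulr1.
rewrite RintegralD//.
have -> : \int[P]_w A w = l / (1 - r).
  have := gen 1; rewrite mulr1 => <-; last by rewrite ler01 lexx.
  by apply: eq_Rintegral => w _; rewrite expr1n mulr1.
set I := \int[P]_w _ => cvI.
have cv2 : series (fun m =>
    (1 + (-1) ^+ m) * \int[P]_(w in M @^-1` [set m]) A w) @ \oo -->
    l / (1 - r) + l / (1 + r).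
  rewrite (_ : series _ = series (geometric l r) \+ series (geometric l (- r))).
    apply: cvgD; first by apply: cvg_geometric_series; rewrite ger0_norm.
    rewrite -{2}[r]opprK; apply: cvg_geometric_series.
    by rewrite normrN ger0_norm.
  apply/funext => n; rewrite /series /= -big_split; apply: eq_bigr => m _ /=.
  by rewrite coef [(- r) ^+ m]exprNn; ring.
exact: (addrI _ (cvg_unique _ cvI cv2)).
Qed.

End count_series.

(** * The generating functional at signed test functions *)

(** This is [f^+ + t f^-]: the test function [f] at [t = -1], its absolute value
    at [t = 1], and [0,1]-valued for [0 <= t <= 1] if [f] is bounded by [1]. *)
Definition sign_split {R : realType} (f : R -> R) (t u : R) : R :=
  Num.max (f u) 0 + t * Num.max (- f u) 0.

Section sign_split.
Context {R : realType} (f : R -> R).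

Lemma sign_splitE t u : sign_split f t u = `|f u| * t ^+ (f u < 0)%R.
Proof.
rewrite /sign_split; have [fu|fu] := ltP (f u) 0.
  by rewrite ltr0_norm// expr1 max_l ?oppr_ge0 1?ltW// add0r mulrC.
by rewrite ger0_norm// expr0 mulr1 max_r ?oppr_le0// mulr0 addr0.
Qed.

Lemma sign_splitN1 : sign_split f (-1) = f.
Proof.
apply/funext => u; rewrite sign_splitE; have [fu|fu] := ltP (f u) 0.
  by rewrite ltr0_norm// expr1 mulrN1 opprK.
by rewrite ger0_norm// expr0 mulr1.
Qed.

Hypothesis mf : measurable_fun setT f.

Lemma measurable_sign_split t : measurable_fun setT (sign_split f t).
Proof.
apply: measurable_funD; first exact: measurable_maxr.
apply: measurable_funM => //; apply: measurable_maxr => //.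
exact: measurableT_comp.
Qed.

End sign_split.

Section pgfl_extension.
Context {R : realType} (nu : probability R R) (alpha : R).
Hypothesis alpha01 : 0 < alpha < 1.
Hypothesis nu01 : nu `[0, 1]%classic = 1%E.

Lemma law_pm1_full : law_pm1 nu `[-1, 1]%classic = 1%E.
Proof.
rewrite -nu01; congr (nu _); apply/seteqP.
by split=> p /=; rewrite !in_itv /= /to_pm1; lra.
Qed.

Variable f : R -> R.
Hypothesis mf : measurable_fun setT f.
Hypothesis f1 : forall u, -1 <= u <= 1 -> `|f u| <= 1.

Let g := \int[law_pm1 nu]_(u in `[-1, 1]) Num.max (f u) 0.
Let h := \int[law_pm1 nu]_(u in `[-1, 1]) Num.max (- f u) 0.

Let int1 (k : R -> R) : measurable_fun setT k ->
  (forall u, -1 <= u <= 1 -> `|k u| <= 1) ->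
  (law_pm1 nu).-integrable `[-1, 1] (EFin \o k).
Proof.
move=> mk k1; apply: (@bounded_integrable _ _ _ _ _ _ 1) => //.
exact: measurable_funTS.
Qed.

Let int_pos : (law_pm1 nu).-integrable `[-1, 1]
  (EFin \o (fun u => Num.max (f u) 0)).
Proof.
apply: int1 => [|u /f1]; first exact: measurable_maxr.
rewrite ler_norml; case: (leP (f u) 0) => ? ?; rewrite ?normr0 ?ler01//.
by rewrite ger0_norm; lra.
Qed.

Let int_neg : (law_pm1 nu).-integrable `[-1, 1]
  (EFin \o (fun u => Num.max (- f u) 0)).
Proof.
apply: int1 => [|u /f1].
  by apply: measurable_maxr => //; exact: measurableT_comp.
rewrite ler_norml; case: (leP (- f u) 0) => ? ?; rewrite ?normr0 ?ler01//.
by rewrite ger0_norm; lra.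
Qed.

(** The denominator is affine in [t], so the functional is a geometric series
    in [t]. *)
Lemma geometric_pgfl_sign_split t :
  geometric_pgfl alpha nu (sign_split f t) =
  sign_split f t 1 / (1 + alpha / (1 - alpha) * (1 - (g + t * h))).
Proof.
rewrite /geometric_pgfl; congr (_ / (1 + _ * _)).
have int_tneg : (law_pm1 nu).-integrable `[-1, 1]
    (EFin \o (fun u => t * Num.max (- f u) 0)).
  exact: (integrableZl _ _ int_neg).
rewrite RintegralB//; last 2 first.
- by apply: int1 => // u _; rewrite normr1.
- exact: (integrableD _ int_pos int_tneg).
have -> : \int[law_pm1 nu]_(u in `[-1, 1]) 1 = 1 :> R.
  by rewrite Rintegral_cst// mul1r; exact: (congr1 fine law_pm1_full).
by rewrite RintegralD// RintegralZl.
Qed.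

(** These inequalities put the ratio of that geometric series in [0,1). *)
Lemma sign_split_masses : [/\ 0 <= g, 0 <= h & g + h <= 1].
Proof.
split.
- by apply: Rintegral_ge0 => u _; rewrite le_max lexx orbT.
- by apply: Rintegral_ge0 => u _; rewrite le_max lexx orbT.
rewrite -RintegralD//; apply: le_trans (ler_norm _) _.
apply: norm_Rintegral_le1 => //.
  apply: measurable_funTS; apply: measurable_funD; first exact: measurable_maxr.
  by apply: measurable_maxr => //; exact: measurableT_comp.
move=> u /=; rewrite in_itv/= => /f1; have := sign_splitE f 1 u.
by rewrite /sign_split mul1r expr1n mulr1 => ->; rewrite normr_id.
Qed.

Context {d : measure_display} {T : measurableType d} (P : probability T R).
Variables (N : {RV P >-> nat}) (xi : nat -> {RV P >-> R}).
Hypothesis N_xi : point_process_with_pgfl N xi (geometric_pgfl alpha nu).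
Hypothesis f1_ge0 : 0 <= f 1.

Lemma measurable_prod_points (k : R -> R) : measurable_fun setT k ->
  measurable_fun setT (fun w => \prod_(j < N w) k (xi j w)).
Proof.
move=> mk; apply: (measurable_fun_random_index
  (F := fun n w => \prod_(j < n) k (xi j w))) => // n.
by apply: measurable_prod => j _; exact: measurableT_comp.
Qed.

Let neg_count w : nat := \sum_(j < N w) (f (xi j w) < 0)%R.

Let measurable_neg_count : measurable_fun setT neg_count.
Proof.
apply: (measurable_fun_random_index
  (F := fun n w => (\sum_(j < n) (f (xi j w) < 0)%R)%N)) => //.
elim=> [|n IH].
  by under eq_fun do rewrite big_ord0; exact: measurable_cst.
rewrite (_ : (fun w => _) = (fun w => if f (xi n w) < 0
    then (\sum_(j < n) (f (xi j w) < 0)%R).+1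
    else (\sum_(j < n) (f (xi j w) < 0)%R)%N)).
  apply: measurable_fun_ifT => //.
    by apply: measurable_fun_ltr => //; exact: measurableT_comp.
  by apply: (measurableT_comp (f := succn)) => // _ B mB.
by apply/funext => w; rewrite big_ord_recr /=; case: ifP; rewrite ?addn1 ?addn0.
Qed.

(** The functional at [sign_split f t], for [0 <= t <= 1], is the generating
    function of the number of points where [f] is negative, weighted by the
    product of the [`|f (xi j)|]; the formula extends to [t = -1], where
    [sign_split f t] is [f]. The sign condition at [1] keeps the numerator
    [sign_split f t 1] independent of [t]. *)
Lemma pgfl_signed :
  \int[P]_w (\prod_(j < N w) f (xi j w)) = geometric_pgfl alpha nu f.
Proof.
have [xi1 pgfl] := N_xi.
pose A w := \prod_(j < N w) `|f (xi j w)|.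
have A_split t w :
    A w * t ^+ neg_count w = \prod_(j < N w) sign_split f t (xi j w).
  rewrite /A /neg_count -prodrXr -big_split; apply: eq_bigr => j _.
  by rewrite sign_splitE.
have mA : measurable_fun setT A.
  apply: (measurable_prod_points (k := fun u => `|f u|)).
  exact: measurableT_comp.
have A01 w : 0 <= A w <= 1.
  rewrite prodr_ge0//=; apply: prodr_ile1 => j _.
  by rewrite normr_ge0 f1// xi1.
have [g0 h0 gh] := sign_split_masses.
set c := alpha / (1 - alpha).
have c0 : 0 < c by case/andP: alpha01 => a0 a1; rewrite divr_gt0// subr_gt0.
(* the denominator at [t] is [D * (1 - c * h / D * t)] *)
set D := 1 + c * (1 - g).
have ch : c * h < D by rewrite /D; nra.
have D0 : 0 < D by rewrite (le_lt_trans _ ch)// mulr_ge0// ltW.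
have split1 t : sign_split f t 1 = f 1.
  by rewrite sign_splitE ltNge f1_ge0 expr0 mulr1 ger0_norm.
have denE t : 1 + c * (1 - (g + t * h)) = D * (1 - c * h / D * t).
  by rewrite /D; field; rewrite -/D gt_eqF.
rewrite -[in RHS](sign_splitN1 f) geometric_pgfl_sign_split split1 -/c denE.
rewrite mulrN1 opprK invfM mulrA.
rewrite -(@signed_generating_function _ _ _ P A neg_count) //.
- apply: eq_Rintegral => w _; rewrite A_split; apply: eq_bigr => j _.
  by rewrite sign_splitN1.
- by rewrite divr_ge0// ltW.
- apply/andP; split; last by rewrite ltr_pdivrMr// mul1r.
  by apply: divr_ge0; [apply: mulr_ge0 => //|]; exact: ltW.
move=> t /andP[t0 t1].
transitivity (geometric_pgfl alpha nu (sign_split f t)); last first.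
  by rewrite geometric_pgfl_sign_split split1 -/c denE invfM mulrA.
apply: EFin_inj; rewrite -pgfl.
- rewrite unlock EFin_Rintegral//.
    by apply: eq_integral => w _; rewrite A_split.
  apply: (@bounded_integrable _ _ _ P _ _ 1) => //;
    first exact: measurable_weight.
  move=> w _; case/andP: (A01 w) => A0 A1.
  by rewrite ger0_norm ?mulr_ge0 ?exprn_ge0// mulr_ile1 ?exprn_ge0 ?exprn_ile1.
- exact: measurable_sign_split.
move=> u u1; rewrite sign_splitE mulr_ge0 ?exprn_ge0//=.
by rewrite mulr_ile1 ?exprn_ge0 ?exprn_ile1 ?f1.
Qed.

End pgfl_extension.

(** * The law of the mixing variable *)

Section mixing_variable.
Context {R : realType} (nu : probability R R) (alpha : R).
Hypothesis alpha01 : 0 < alpha < 1.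
Hypothesis nu01 : nu `[0, 1]%classic = 1%E.
Context {d : measure_display} {T : measurableType d} (P : probability T R).
Variables (N : {RV P >-> nat}) (xi : nat -> {RV P >-> R}).
Hypothesis N_xi : point_process_with_pgfl N xi (geometric_pgfl alpha nu).
Variables Y V : {RV P >-> R}.
Hypothesis Y_prod : forall w, Y w = \prod_(j < N w) xi j w.
Hypothesis V_Y : forall w, V w = 1 / 2 - Y w / 2.

(** A change of variables turns the moments of [law_pm1 nu] into those of the
    bits. *)
Lemma geometric_pgfl_exp k :
  geometric_pgfl alpha nu (fun u => u ^+ k) =
  (1 - alpha) / (1 - alpha * bit_moment nu k).
Proof.
have bk : bit_moment nu k <= 1.
  by rewrite (le_trans (ler_norm _))// bit_moment_le1.
have [a0 a1] := andP alpha01.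
have int_exp := integrable_pm1_exp nu k.
have int_1 : nu.-integrable `[0, 1] (EFin \o (fun=> 1 : R)).
  by apply: (@bounded_integrable _ _ _ nu _ _ 1) => // p _; rewrite normr1.
have pm1E : @to_pm1 R @^-1` `[-1, 1] = `[0, 1]%classic.
  by apply/seteqP; split=> p /=; rewrite !in_itv /= /to_pm1; lra.
rewrite /geometric_pgfl expr1n.
have -> : \int[law_pm1 nu]_(u in `[-1, 1]) (1 - u ^+ k) = 1 - bit_moment nu k.
  transitivity (\int[nu]_(p in `[0, 1]) (1 - (1 - 2 * p) ^+ k)).
    rewrite /Rintegral /law_pm1 /distribution integral_pushforward//= ?pm1E//.
      by apply/measurable_EFinP; exact: measurable_funB.
    exact: (integrableB _ int_1 int_exp).
  rewrite RintegralB// Rintegral_cst// mul1r.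
  by rewrite (_ : fine _ = 1)//; exact: (congr1 fine nu01).
have D0 : 0 < 1 - alpha * bit_moment nu k by nra.
by field; rewrite gt_eqF//= gt_eqF// subr_gt0.
Qed.

Lemma Y_bound w : -1 <= Y w <= 1.
Proof.
rewrite -ler_norml Y_prod normr_prod; apply: prodr_ile1 => j _.
by rewrite normr_ge0 /= ler_norml; apply: N_xi.1.
Qed.

Lemma V_bound w : 0 <= V w <= 1.
Proof. by have := Y_bound w; rewrite V_Y; lra. Qed.

Lemma Y_moment k :
  \int[P]_w (Y w ^+ k) = (1 - alpha) / (1 - alpha * bit_moment nu k).
Proof.
rewrite -geometric_pgfl_exp.
rewrite -(pgfl_signed alpha01 nu01 _ _ N_xi)//.
- by apply: eq_Rintegral => w _; rewrite Y_prod prodrXl.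
- by move=> u u1; rewrite normrX exprn_ile1// ler_norml.
Qed.

Lemma V_unit : distribution P V `[0, 1]%classic = 1%E.
Proof.
rewrite -(@probability_setT _ _ _ P); congr (P _).
by apply/seteqP; split=> // w _ /=; rewrite in_itv; exact: V_bound.
Qed.

(** As [1 - 2 V = Y], the Bernoulli product at [V] is the Walsh inversion of the
    powers of [Y]; taking expectations replaces them by the moments of [Y]. *)
Lemma V_bernoulli_mixture n (e : {ffun 'I_n -> bool}) :
  (\int[distribution P V]_(p in `[0%R, 1%R])
     (\prod_(i < n) bernoulli_pmf p (e i))%:E)%E =
  (walsh_inv (fun k => (1 - alpha) / (1 - alpha * bit_moment nu k)) e)%:E.
Proof.
have VT : V @^-1` `[0, 1] = setT.
  by apply/seteqP; split=> // w _ /=; rewrite in_itv; exact: V_bound.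
have intY k : P.-integrable setT (EFin \o (fun w => Y w ^+ k)).
  apply: (@bounded_integrable _ _ _ P _ _ 1) => //;
    first exact: measurable_funX.
  by move=> w _; rewrite normrX exprn_ile1// ler_norml Y_bound.
have bernV w : \prod_(i < n) bernoulli_pmf (V w) (e i) =
    2^-1 ^+ n * \sum_S walsh_char S e * Y w ^+ #|S|.
  rewrite -walsh_inv_exp; congr (_ * _); apply: eq_bigr => S _.
  congr (_ * _ ^+ _).
  by rewrite V_Y; field.
rewrite integral_pushforward//= ?VT; first last.
- apply: (@bounded_integrable _ _ _ P _ _ 1) => //.
    apply: (measurableT_comp
      (f := fun p : R => \prod_(i < n) bernoulli_pmf p (e i))) => //.
    exact: measurable_bernoulli_prod.
  by move=> w _; exact: bernoulli_prod_bound (V_bound w).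
- by apply/measurable_EFinP; exact: measurable_bernoulli_prod.
transitivity (\int[P]_w ((2^-1 ^+ n)%:E *
    \sum_S ((walsh_char S e)%:E * (Y w ^+ #|S|)%:E)))%E.
  by apply: eq_integral => w _; rewrite bernV EFinM -sumEFin.
have intS (S : {set 'I_n}) : P.-integrable setT
    (fun w => (walsh_char S e)%:E * (Y w ^+ #|S|)%:E)%E.
  exact: (integrableZl _ _ (intY _)).
rewrite integralZl//; last exact: integrable_sum.
rewrite integral_sum// /walsh_inv EFinM -sumEFin; congr (_ * _)%E.
apply: eq_bigr => S _; rewrite integralZl//; last exact: intY.
by rewrite -Y_moment EFinM EFin_Rintegral.
Qed.

End mixing_variable.

Theorem corollary6 (R : realType)
    (d : measure_display) (Omega : measurableType d) (P : probability Omega R)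
    (nu : probability R R) (alpha : R) (x : binseq)
    (Z X : nat -> {RV P >-> binseq}) (T : {RV P >-> nat})
    (halpha : 0 < alpha < 1)
    (hZ : forall t, de_finetti P nu (Z t))
    (hZ_indep : mutually_independent P Z)
    (hX0 : forall w, X 0%N w = x)
    (hXS : forall t w, X t.+1 w = X t w + Z t w)
    (hT : forall t : nat,
       P [set w | T w = t] = ((1 - alpha) * alpha ^+ t)%:E)
    (hT_indep : independent_of_process P T X)
    (d' : measure_display) (Omega' : measurableType d')
    (P' : probability Omega' R)
    (N : {RV P' >-> nat}) (xi : nat -> {RV P' >-> R})
    (hxi : point_process_with_pgfl N xi (geometric_pgfl alpha nu))
    (Y V : {RV P' >-> R})
    (hY : forall w, Y w = \prod_(j < N w) xi j w)
    (hV : forall w, V w = 1 / 2 - Y w / 2) :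
  de_finetti P (distribution P' V) (fun w => X (T w) w - x).
Proof.
have [_ nu01 _ _] := hZ 0%N.
have Z_mixed t : mixed_bernoulli P nu (Z t) by case: (hZ t).
have W_mixed : mixed_bernoulli P (distribution P' V) (fun w => X (T w) w - x).
  move=> n e; rewrite (bits_preimage (fun w => X (T w) w - x)).
  apply: etrans (stopped_displacement_law halpha Z_mixed hZ_indep hX0 hXS hT
    hT_indep (finfun e)) _.
  rewrite -(V_bernoulli_mixture halpha nu01 hxi hY hV).
  apply: eq_integral => p _; congr EFin.
  by apply: eq_bigr => i _; rewrite ffunE.
split=> //; last exact: mixed_bernoulli_exchangeable W_mixed.
  apply: (@measurable_fun_random_index _ _ _ binseq T
    (fun t w => X t w - x)) => // t.
  apply: measurable_fun_binseq => i b.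
  rewrite (_ : [set w | _] = X t @^-1` [set z : binseq | z i = b + x i]).
    rewrite -[X in measurable X]setTI; apply: measurable_funPT => //.
    exact: measurable_coordinate.
  apply/seteqP; split=> w /=.
    by move=> <-; rewrite (_ : (X t w - x) i = X t w i - x i)// subrK.
  by rewrite (_ : (X t w - x) i = X t w i - x i)// => ->; rewrite addrK.
exact: (V_unit hxi hY hV).
Qed.
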